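(* Consider the two-sided interconnection $$\dot\omega=S\omega,\qquad \dot x=Ax+BL\omega,\qquad \dot\varpi=Q\varpi+RCx,\qquad d=\varpi+\Upsilon x,$$ with $\varpi(0)=0$, $x(0)=0$ and $\omega(0)=\omega_0$, where $\Upsilon,\Pi$ are the unique solutions of the Sylvester equations $A\Pi+BL=\Pi S$ and $Q\Upsilon=\Upsilon A+RC$. Suppose that: (1) $(S,L)$ is observable and $(Q,R)$ is controllable; (2) $\sigma(A)\subset\mathbb{C}_{<0}$, $S$ has simple eigenvalues with $\sigma(S)\subset\mathbb{C}_0$, and $(S,\omega_0)$ is excitable; (3) $Q$ has simple eigenvalues with $\sigma(Q)\subset\mathbb{C}_0$; (4) $\sigma(S)\cap\sigma(A)=\emptyset$, $\sigma(Q)\cap\sigma(A)=\emptyset$, $\sigma(S)\cap\sigma(Q)=\emptyset$. Let $\widetilde{\Upsilon B}_i\in\mathbb{R}^{\nu}$ be the (fixed) estimate of $\Upsilon B$ described in the context, and let $\hat d(t)\in\mathbb{R}^\nu$ be the solution of the surrogate system $$\dot{\hat d}=Q\hat d+\widetilde{\Upsilon B}_i L\omega,\qquad \hat d(0)=0.$$ Let $p\ge\nu$ be an integer and, for sampling times $\{t_k\}$, define $O_k\in\mathbb{R}^{p\nu\times\nu^2}$ and $\widehat P_k\in\mathbb{R}^{p\nu}$ by $$O_k=\begin{bmatrix}\omega(t_{k-p+1})^\top\otimes I_\nu\\ \vdots\\ \omega(t_{k-1})^\top\otimes I_\nu\\ \omega(t_k)^\top\otimes I_\nu\end{bmatrix},\qquad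 \widehat P_k=\begin{bmatrix}\hat d(t_{k-p+1})-\varpi(t_{k-p+1})\\ \vdots\\ \hat d(t_{k-1})-\varpi(t_{k-1})\\ \hat d(t_k)-\varpi(t_k)\end{bmatrix}.$$ Then there exists a sequence $\{t_k\}$ with $\lim_{k\to\infty}t_k=\infty$ such that, for the approximate estimate $\widehat{\Upsilon\Pi}_k\in\mathbb{R}^{\nu\times\nu}$ defined by $$\operatorname{vec}(\widehat{\Upsilon\Pi}_k):=(O_k^\top O_k)^{-1}O_k^\top\widehat P_k,$$ there exists $\gamma>0$ such that, as $k$ approaches infinity, $\|\widehat{\Upsilon\Pi}_k-\Upsilon\Pi\|_\infty\le\gamma$, i.e. $\limsup_{k\to\infty}\|\widehat{\Upsilon\Pi}_k-\Upsilon\Pi\|_\infty\le\gamma$.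
   Context: Setting: $A\in\mathbb{R}^{n\times n}$, $B\in\mathbb{R}^{n\times1}$, $C\in\mathbb{R}^{1\times n}$ define a minimal (controllable and observable) SISO linear system $\dot x=Ax+Bu$, $y=Cx$. $S,Q\in\mathbb{R}^{\nu\times\nu}$, $L\in\mathbb{R}^{1\times\nu}$, $R\in\mathbb{R}^{\nu\times1}$. The matrices $\Pi\in\mathbb{R}^{n\times\nu}$ and $\Upsilon\in\mathbb{R}^{\nu\times n}$ are the unique solutions of $A\Pi+BL=\Pi S$ and $Q\Upsilon=\Upsilon A+RC$ (unique because $\sigma(S)\cap\sigma(A)=\sigma(Q)\cap\sigma(A)=\emptyset$). Notation: $\sigma(\cdot)$ is the spectrum; $\mathbb{C}_0$ (resp. $\mathbb{C}_{<0}$) is the set of complex numbers with zero (resp. negative) real part; $\otimes$ is the Kronecker product; $\operatorname{vec}$ stacks the columns of a matrix; $\|\cdot\|_\infty$ of the matrix error is the sup norm of its vectorization (maximum absolute entry). Excitable pair: $(S,\omega_0)$ is excitable if $\operatorname{rank}[\omega_0\ \ S\omega_0\ \cdots\ S^{\nu-1}\omega_0]=\nu$. Estimate of $\Upsilon B$: in a separate experiment, consider the swapped interconnection $\dot x=Ax+Bu$, $\dot\varpi=Q\varpi+RCx$ with $x(0)=0$, $\varpi(0)=0$ and $u$ the Dirac delta at time $0$ (so $x(t)=e^{At}B$ for $t>0$). For a fixed time $\tau_i>0$ the estimate is $\widetilde{\Upsilon B}_i:=e^{-Q\tau_i}\varpi(\tau_i)$; equivalently $\Upsilon B-\widetilde{\Upsilon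 B}_i=e^{-Q\tau_i}\Upsilon e^{A\tau_i}B$. Sampling times are nonnegative, and $k$ ranges over indices for which all of $t_{k-p+1},\dots,t_k$ are defined. *)

(* Defs.v *)
From HB Require Import structures.
From mathcomp Require Import all_boot all_order all_algebra.
From mathcomp Require Import all_classical all_reals all_analysis.
From mathcomp Require Import complex mxtens.

Set Implicit Arguments.
Unset Strict Implicit.
Unset Printing Implicit Defensive.

Import Order.TTheory GRing.Theory Num.Theory.
Import numFieldNormedType.Exports.
Local Open Scope classical_set_scope.
Local Open Scope ring_scope.

Definition ctrb_mx (K : fieldType) n (A : 'M[K]_n) (b : 'cV[K]_n) : 'M[K]_n :=
  \matrix_(i < n, j < n) (A ^+ j *m b) i ord0.

Definition obsv_mx (K : fieldType) n (A : 'M[K]_n) (c : 'rV[K]_n) : 'M[K]_n :=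
  \matrix_(i < n, j < n) (c *m A ^+ i) ord0 j.

Definition controllable (K : fieldType) n (A : 'M[K]_n) (b : 'cV[K]_n) : Prop :=
  \rank (ctrb_mx A b) = n.

Definition observable (K : fieldType) n (A : 'M[K]_n) (c : 'rV[K]_n) : Prop :=
  \rank (obsv_mx A c) = n.

(* The matrix [w0, S w0, ..., S^(n-1) w0] is ctrb_mx S w0. *)
Definition excitable (K : fieldType) n (S : 'M[K]_n) (w0 : 'cV[K]_n) : Prop :=
  \rank (ctrb_mx S w0) = n.

Definition complexify (K : realType) n (A : 'M[K]_n) : 'M[K[i]]_n :=
  map_mx (real_complex K) A.

Definition spectrum (K : realType) n (A : 'M[K]_n) : set K[i] :=
  [set z | eigenvalue (complexify A) z].

(* Simple means of algebraic multiplicity one. *)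
Definition simple_eigenvalues (K : realType) n (A : 'M[K]_n) : Prop :=
  forall z, spectrum A z -> mup z (char_poly (complexify A)) = 1%N.

Definition imaginary_axis (K : realType) : set K[i] :=
  [set z | complex.Re z = 0].

Definition open_left_half_plane (K : realType) : set K[i] :=
  [set z | complex.Re z < 0].

Definition expmx (K : realType) n (A : 'M[K]_n) : 'M[K]_n :=
  limn (series (fun k : nat => (k`!%:R)^-1 *: A ^+ k)).

(* z is a solution on [0, +oo[, with velocity dz and initial value z0. The
   values of z at negative times are irrelevant, and at time 0 only continuity
   from the right is required. *)
Definition trajectory (K : realType) n (z0 : 'cV[K]_n) (dz z : K -> 'cV[K]_n) :
    Prop :=
  [/\ z 0 = z0,
      {within `[0, +oo[, continuous z} &
      forall t : K, 0 < t -> is_derive t 1 z (dz t)].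

(* State of x' = A x + B u when x(0) = 0 and u is the Dirac delta at time 0:
   the impulse makes the state jump from 0 to B. *)
Definition impulse_state (K : realType) n (A : 'M[K]_n) (B : 'cV[K]_n) (t : K) :
    'cV[K]_n :=
  if 0 < t then expmx (t *: A) *m B else 0.

(* mxvec and vec_mx are row-major; the transpositions make the columns of the
   matrix be stacked. *)
Definition vec (K : Type) m n (M : 'M[K]_(m, n)) : 'cV[K]_(n * m) :=
  (mxvec M^T)^T.

Definition unvec (K : Type) m n (v : 'cV[K]_(n * m)) : 'M[K]_(m, n) :=
  (vec_mx v^T)^T.

Lemma vecK (K : Type) m n : cancel (@vec K m n) (@unvec K m n).
Proof. by move=> M; rewrite /vec /unvec trmxK mxvecK trmxK. Qed.

Lemma unvecK (K : Type) m n : cancel (@unvec K m n) (@vec K m n).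
Proof. by move=> v; rewrite /vec /unvec trmxK vec_mxK trmxK. Qed.

Lemma index_allpairs (T1 T2 : eqType) (s : seq T1) (t : seq T2) x y :
  uniq s -> x \in s -> y \in t ->
  index (x, y) [seq (a, b) | a <- s, b <- t] = (index x s * size t + index y t)%N.
Proof.
elim: s => //= a s IH /andP[as_ us]; rewrite inE index_cat.
have inj : injective (pair a : T2 -> T1 * T2) by move=> ? ? [].
case: (eqVneq x a) => [-> _ yt|xa /= xs yt].
  by rewrite mem_map // yt index_map // mul0n add0n.
have -> : ((x, y) \in [seq (a, b) | b <- t]) = false.
  by apply/negP => /mapP[b _ [xa' _]]; rewrite xa' eqxx in xa.
by rewrite size_map IH // mulSn addnA.
Qed.

Lemma mxvec_index_mxtens m n (i : 'I_m) (j : 'I_n) :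
  mxvec_index i j = mxtens_index (i, j).
Proof.
apply: val_inj => /=.
have -> : nat_of_ord (enum_rank (i, j)) = index (i, j) (enum {: 'I_m * 'I_n}).
  rewrite -[in RHS](enum_rankK (i, j)) /enum_val index_uniq ?enum_uniq //.
  by rewrite -cardE ltn_ord.
have -> : enum {: 'I_m * 'I_n} = [seq (a, b) | a <- enum 'I_m, b <- enum 'I_n].
  by rewrite enumT unlock.
by rewrite index_allpairs ?mem_enum ?enum_uniq // !index_enum_ord size_enum_ord.
Qed.

Lemma vecE (K : Type) m n (M : 'M[K]_(m, n)) i j :
  vec M (mxtens_index (j, i)) ord0 = M i j.
Proof. by rewrite -mxvec_index_mxtens mxE mxvecE mxE. Qed.

Lemma tens_tr_vec (K : realType) n (w : 'cV[K]_n) (M : 'M[K]_n) :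
  castmx (mul1n n, erefl) (w^T *t (1%:M : 'M[K]_n)) *m vec M = M *m w.
Proof.
apply/matrixP => i j; rewrite !mxE.
rewrite (reindex (@mxtens_index n n)) /=; last first.
  by exists (@mxtens_unindex n n) => ? _;
    [exact: mxtens_indexK | exact: mxtens_unindexK].
set F := fun a b =>
  castmx (mul1n n, erefl) (w^T *t (1%:M : 'M[K]_n)) i (mxtens_index (a, b)) *
  vec M (mxtens_index (a, b)) j.
rewrite (eq_bigr (fun q => F q.1 q.2)); last by case.
rewrite -(pair_bigA _ F) /F /=.
apply: eq_bigr => a _; rewrite (bigD1 i) //= big1 ?addr0; last first.
  move=> b bi; rewrite castmxE /= cast_ord_id.
  have -> : cast_ord (esym (mul1n n)) i = mxtens_index (ord0, i) by apply: val_inj.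
  by rewrite tensmxE !mxE [i == b]eq_sym (negbTE bi) mulr0 mul0r.
rewrite castmxE /= cast_ord_id.
have -> : cast_ord (esym (mul1n n)) i = mxtens_index (ord0, i) by apply: val_inj.
by rewrite tensmxE !ord1 vecE !mxE eqxx mulr1 mulrC.
Qed.

(* The blocks F 0, ..., F (p - 1) on top of each other; row a of block j is
   row j * m + a of the result. *)
Definition stack_mx (K : Type) p m n (F : 'I_p -> 'M[K]_(m, n)) :
    'M[K]_(p * m, n) :=
  \matrix_(i, j) F (mxtens_unindex i).1 (mxtens_unindex i).2 j.

(* Block j of the window of length p that ends at index k is taken at time
   t_(k - p + 1 + j); this is meaningful for p <= k + 1. *)
Definition window (K : Type) (t : nat -> K) p k (j : 'I_p) : K :=
  t (k.+1 - p + j)%N.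

Definition O_mx (K : realType) nu p (omega : K -> 'cV[K]_nu) (t : nat -> K)
    (k : nat) : 'M[K]_(p * nu, nu * nu) :=
  stack_mx (fun j : 'I_p =>
    castmx (mul1n nu, erefl) ((omega (window t k j))^T *t (1%:M : 'M[K]_nu))).

Definition P_mx (K : realType) nu p (dhat varpi : K -> 'cV[K]_nu)
    (t : nat -> K) (k : nat) : 'cV[K]_(p * nu) :=
  stack_mx (fun j : 'I_p => dhat (window t k j) - varpi (window t k j)).

Definition moment_estimate (K : realType) nu p
    (omega dhat varpi : K -> 'cV[K]_nu) (t : nat -> K) (k : nat) : 'M[K]_nu :=
  let O := O_mx p omega t k in
  unvec (invmx (O^T *m O) *m O^T *m P_mx p dhat varpi t k).

(* Main.v *)
(* The sampling times are t_k = k h. The residual dhat - varpi - Upsilon Pi omega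
   is bounded: omega because S is marginally stable, x - Pi omega because it
   solves z' = A z with A Hurwitz, and dhat and varpi + Upsilon x because both
   solve z' = Q z + G omega, which does not resonate as S and Q share no
   eigenvalue. All of this is read off the
   scalar curves v z(t), for complex rows v, in particular left eigenvectors, so
   that no matrix exponential is needed. For h small, the numbers e^(i theta h),
   with i theta the eigenvalues of S, are distinct, so nu consecutive samples
   of omega form a matrix with uniformly bounded inverse, by a Vandermonde
   factorization; hence least squares amplifies the residual by a factor that
   does not depend on k. *)
Require Import Defs.
From HB Require Import structures.
From mathcomp Require Import all_boot all_order all_algebra.
From mathcomp Require Import all_classical all_reals all_analysis.
From mathcomp Require Import complex mxtens.
From mathcomp Require Import ring.

Set Implicit Arguments.
Unset Strict Implicit.
Unset Printing Implicit Defensive.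

Import Order.TTheory GRing.Theory Num.Theory.
Import numFieldNormedType.Exports.
Local Open Scope classical_set_scope.
Local Open Scope ring_scope.

(** * Differential inequalities for real functions on the half-line *)

Section HalfLine.
Variable K : realType.
Implicit Types (f g df dg : K -> K).

(** Scalar counterpart of [trajectory] with the initial value left out. Continuity on the closed
    half-line is what carries monotonicity on positive times down to time 0. *)
Definition curve f df : Prop :=
  {within `[0, +oo[, continuous f} /\
  forall t : K, 0 < t -> is_derive t 1 f (df t).

Lemma curve_ext f g df dg :
  f =1 g -> (forall t, 0 < t -> df t = dg t) -> curve f df -> curve g dg.
Proof.
move=> /funext <- fg [cf Df]; split=> // t t0; rewrite -fg //; exact: Df.
Qed.

Lemma curve_is_derive f df :
  (forall t : K, is_derive t 1 f (df t)) -> curve f df.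
Proof.
move=> Df; split; last by move=> t _; exact: Df.
apply: derivable_within_continuous => t _.
by have [] := Df t.
Qed.

Lemma curve_cst (c : K) : curve (fun=> c) (fun=> 0).
Proof. by apply: curve_is_derive => t; exact: is_derive_cst. Qed.

Lemma curveD f g df dg :
  curve f df -> curve g dg ->
  curve (fun t => f t + g t) (fun t => df t + dg t).
Proof.
move=> [cf Df] [cg Dg]; split.
  by move=> t; apply: continuousD; [exact: cf | exact: cg].
move=> t t0; have ? := Df _ t0; have ? := Dg _ t0.
exact: is_deriveD.
Qed.

Lemma curveM f g df dg :
  curve f df -> curve g dg ->
  curve (fun t => f t * g t) (fun t => df t * g t + f t * dg t).
Proof.
move=> [cf Df] [cg Dg]; split.
  by move=> t; apply: continuousM; [exact: cf | exact: cg].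
move=> t t0; have ? := Df _ t0; have ? := Dg _ t0.
apply: (@is_derive_eq _ _ _ _ _ _ _ _ (is_deriveM _ _)).
by rewrite addrC /GRing.scale /= mulrC.
Qed.

Lemma curveZ (c : K) f df : curve f df -> curve (fun t => c * f t) (fun t => c * df t).
Proof.
move=> cf; apply: curve_ext (curveM (curve_cst c) cf) => // t _.
by rewrite mul0r add0r.
Qed.

Lemma curve_sum (I : Type) (r : seq I) (F dF : I -> K -> K) :
  (forall i, curve (F i) (dF i)) ->
  curve (fun t => \sum_(i <- r) F i t) (fun t => \sum_(i <- r) dF i t).
Proof.
move=> FdF; elim: r => [|i r IH].
  by apply: curve_ext (curve_cst 0) => t; rewrite ?big_nil.
by apply: curve_ext (curveD (FdF i) IH) => t; rewrite ?big_cons.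
Qed.

Lemma curve_nincr f df : curve f df -> (forall t, 0 < t -> df t <= 0) ->
  forall t, 0 <= t -> f t <= f 0.
Proof.
move=> [cf Df] df0 t t0; apply: (@ler0_derive1_nincry K f 0) => //.
  by move=> s; rewrite in_itv /= andbT => s0; have [] := Df s s0.
move=> s; rewrite in_itv /= andbT => s0.
by rewrite derive1E; have [_ ->] := Df s s0; exact: df0.
Qed.

Lemma curve_const f df : curve f df -> (forall t, 0 < t -> df t = 0) ->
  forall t, 0 <= t -> f t = f 0.
Proof.
move=> cf df0 t t0; apply/eqP; rewrite eq_le (curve_nincr cf) //=; last first.
  by move=> s /df0 ->.
have : -1 * f t <= -1 * f 0.
  by apply: (curve_nincr (curveZ (-1) cf)) => // s /df0 ->; rewrite mulr0.
by rewrite !mulN1r lerN2.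
Qed.

(* Gronwall: [exp (a t) * (f t - c / a)] is nonincreasing. *)
Lemma curve_gronwall f df (a c : K) : 0 < a -> curve f df ->
  (forall t, 0 < t -> df t <= c - a * f t) ->
  forall t, 0 <= t -> f t <= `|f 0| + `|c / a|.
Proof.
move=> a0 cf dfle t t0.
have cE : curve (fun t => expR (a * t)) (fun t => a * expR (a * t)).
  apply: curve_is_derive => s.
  apply: is_derive_eq; rewrite /GRing.scale /= mulr1.
  by rewrite mulrC.
have cg := curveM cE (curveD cf (curve_cst (- (c / a)))).
have : expR (a * t) * (f t - c / a) <= expR (a * 0) * (f 0 - c / a).
  apply: (curve_nincr cg) => // s s0; rewrite addr0.
  have -> : a * expR (a * s) * (f s - c / a) + expR (a * s) * df s =
     expR (a * s) * (df s - (c - a * f s)) by field; rewrite gt_eqF.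
  by rewrite pmulr_rle0 ?expR_gt0 // subr_le0 dfle.
rewrite mulr0 expR0 mul1r => le1.
have e1 : 1 <= expR (a * t) by rewrite -expR0 ler_expR mulr_ge0 // ltW.
have [fc|fc] := leP (f t) (c / a).
  by rewrite (le_trans fc) // (le_trans (ler_norm _)) // lerDr.
have : f t - c / a <= f 0 - c / a.
  apply: le_trans le1; rewrite ler_peMl // subr_ge0; exact: ltW.
rewrite lerD2r => /le_trans; apply.
by rewrite (le_trans (ler_norm _)) // lerDl.
Qed.

End HalfLine.

(** * Complex functionals of real curves *)

Section ComplexFunctionals.
Variable K : realType.
Local Notation C := K[i].
Local Notation Re := (@complex.Re K).
Local Notation Im := (@complex.Im K).
Local Notation toC := (real_complex K).
Implicit Types (y f : K -> C).

Definition ccurve y dy : Prop :=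
  curve (Re \o y) (Re \o dy) /\ curve (Im \o y) (Im \o dy).

(** The bound lives in [K[i]]: by its partial order, the inequality forces M to be real. *)
Definition cbounded y : Prop :=
  exists M : C, forall t, 0 <= t -> `|y t| <= M.

Lemma ReD (a b : C) : Re (a + b) = Re a + Re b. Proof. by case: a b => ? ? []. Qed.
Lemma ImD (a b : C) : Im (a + b) = Im a + Im b. Proof. by case: a b => ? ? []. Qed.
Lemma ReM (a b : C) : Re (a * b) = Re a * Re b - Im a * Im b.
Proof. by case: a b => ? ? []. Qed.
Lemma ImM (a b : C) : Im (a * b) = Re a * Im b + Im a * Re b.
Proof. by case: a b => ? ? []. Qed.

Lemma ccurve_ext y y' dy dy' : y =1 y' -> (forall t, 0 < t -> dy t = dy' t) ->
  ccurve y dy -> ccurve y' dy'.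
Proof.
move=> yy' dd [cr ci]; split; [move: cr | move: ci].
  by apply: curve_ext => [t|t t0] /=; rewrite ?yy' ?dd.
by apply: curve_ext => [t|t t0] /=; rewrite ?yy' ?dd.
Qed.

Lemma ccurveD y1 y2 dy1 dy2 : ccurve y1 dy1 -> ccurve y2 dy2 ->
  ccurve (fun t => y1 t + y2 t) (fun t => dy1 t + dy2 t).
Proof.
move=> [r1 i1] [r2 i2]; split.
  by apply: curve_ext (curveD r1 r2) => t /=; rewrite ReD.
by apply: curve_ext (curveD i1 i2) => t /=; rewrite ImD.
Qed.

Lemma cboundedD y1 y2 : cbounded y1 -> cbounded y2 ->
  cbounded (fun t => y1 t + y2 t).
Proof.
move=> [M1 b1] [M2 b2]; exists (M1 + M2) => t t0.
by rewrite (le_trans (ler_normD _ _)) // lerD ?b1 ?b2.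
Qed.

Lemma cboundedZ c y : cbounded y -> cbounded (fun t => c * y t).
Proof.
by move=> [M b]; exists (`|c| * M) => t t0; rewrite normrM ler_wpM2l // b.
Qed.

Lemma cbounded_sum (I : Type) (r : seq I) (Y : I -> K -> C) :
  (forall i, cbounded (Y i)) -> cbounded (fun t => \sum_(i <- r) Y i t).
Proof.
move=> bY; elim: r => [|i r [M IH]].
  by exists 0 => t _; rewrite big_nil normr0.
have [N bN] := bY i; exists (N + M) => t t0.
by rewrite big_cons (le_trans (ler_normD _ _)) // lerD ?bN ?IH.
Qed.

Lemma cbounded_ext y1 y2 : (forall t, 0 <= t -> y1 t = y2 t) ->
  cbounded y1 -> cbounded y2.
Proof. by move=> e [M b]; exists M => t t0; rewrite -e // b. Qed.

(* Energy estimate: with [a = - Re l > 0] and [e = |y|^2], Young's inequality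
   gives [e' <= - a e + |f|^2 / a]. *)
Lemma stable_scalar_bounded l y f :
  Re l < 0 -> ccurve y (fun t => l * y t + f t) -> cbounded f -> cbounded y.
Proof.
move=> l0 [cr ci] [M bf].
set a := - Re l; have a0 : 0 < a by rewrite oppr_gt0.
have ce := curveD (curveM cr cr) (curveM ci ci).
have M0 : 0 <= M by apply: le_trans (bf 0 _).
set E := `|Re (y 0) * Re (y 0) + Im (y 0) * Im (y 0)| + `|Re (M ^+ 2) / a / a|.
have gr : forall t, 0 <= t -> Re (y t) ^+ 2 + Im (y t) ^+ 2 <= E.
  move=> t t0; rewrite !expr2.
  apply: (curve_gronwall (c := Re (M ^+ 2) / a) a0 ce) => // s s0 /=.
  have fM : Re (f s) ^+ 2 + Im (f s) ^+ 2 <= Re (M ^+ 2).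
    have : `|f s| ^+ 2 <= M ^+ 2 by rewrite ler_pXn2r ?nnegrE // bf // ltW.
    by rewrite -add_Re2_Im2 lecE => /andP[_].
  rewrite ReD ImD ReM ImM.
  set p := Re (y s); set q := Im (y s).
  set u := Re (f s) in fM *; set v := Im (f s) in fM *.
  have -> : Re l = - a by rewrite opprK.
  set m := Re (M ^+ 2) in fM *.
  rewrite -subr_ge0.
  (* Completing the squares in p and q; the rotation terms with Im l cancel. *)
  have -> : m / a - a * (p * p + q * q) -
     ((- a * p - Im l * q + u) * p + p * (- a * p - Im l * q + u) +
      ((- a * q + Im l * p + v) * q + q * (- a * q + Im l * p + v))) =
     (m - (u ^+ 2 + v ^+ 2)) / a + a * ((p - u / a) ^+ 2 + (q - v / a) ^+ 2).
    by field; rewrite gt_eqF.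
  by rewrite addr_ge0 ?mulr_ge0 ?invr_ge0 ?subr_ge0 ?addr_ge0 ?sqr_ge0 // ltW.
(* Since E <= (1 + E)^2, the bound 1 + E on |y| avoids a square root. *)
exists (1 + E)%:C%C => t t0.
have E0 : 0 <= E by rewrite addr_ge0.
rewrite -(@ler_pXn2r _ 2) ?nnegrE //; last by rewrite ler0c addr_ge0.
rewrite -add_Re2_Im2 -rmorphXn lecR (le_trans (gr t t0)) //.
rewrite -subr_ge0; have -> : (1 + E) ^+ 2 - E = 1 + E + E ^+ 2 by ring.
by rewrite !addr_ge0 ?sqr_ge0.
Qed.

Definition cis (s : K) : C := Complex (cos s) (sin s).

Lemma cis0 : cis 0 = 1. Proof. by rewrite /cis cos0 sin0. Qed.

Lemma cisD s t : cis (s + t) = cis s * cis t.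
Proof. by apply/eqP; rewrite eq_complex /= cosD sinD eqxx /= addrC. Qed.

Lemma norm_cis s : `|cis s| = 1.
Proof. by rewrite normc_def /= cos2Dsin2 sqrtr1. Qed.

(** The product of y t with e^(- i Im l t) has derivative zero; [e1] and [e2] express that its real
    and imaginary parts are constant. *)
Lemma imaginary_scalar_solution l y :
  Re l = 0 -> ccurve y (fun t => l * y t) ->
  forall t, 0 <= t -> y t = cis (Im l * t) * y 0.
Proof.
move=> l0 [cr ci] t t0; set w := Im l.
have cC : curve (fun t => cos (w * t)) (fun t => - (w * sin (w * t))).
  apply: curve_is_derive => s; apply: is_derive_eq.
  by rewrite /GRing.scale /=; ring.
have cS : curve (fun t => sin (w * t)) (fun t => w * cos (w * t)).
  apply: curve_is_derive => s; apply: is_derive_eq.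
  by rewrite /GRing.scale /=; ring.
have e1 := curve_const (curveD (curveM cC cr) (curveM cS ci)).
have e2 := curve_const (curveD (curveM cC ci) (curveM (curveZ (-1) cS) cr)).
have {}e1 : cos (w * t) * Re (y t) + sin (w * t) * Im (y t) = Re (y 0).
  rewrite e1 //= => [|s s0]; first by rewrite mulr0 cos0 sin0 mul1r mul0r addr0.
  by rewrite ReM ImM l0 -/w; ring.
have {}e2 : cos (w * t) * Im (y t) - sin (w * t) * Re (y t) = Im (y 0).
  rewrite -[- (_ * _)]mulN1r mulrA e2 //= => [|s s0].
    by rewrite mulr0 cos0 sin0 mul1r mulr0 mul0r addr0.
  by rewrite ReM ImM l0 -/w; ring.
have -> : y 0 = cis (- (w * t)) * y t.
  apply/eqP; rewrite eq_complex ReM ImM /= cosN sinN -e1 -e2 mulNr opprK eqxx /=.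
  by rewrite mulNr.
by rewrite mulrA -cisD subrr cis0 mul1r.
Qed.

Lemma imaginary_scalar_bounded l y :
  Re l = 0 -> ccurve y (fun t => l * y t) -> cbounded y.
Proof.
move=> l0 cy; exists `|y 0| => t t0.
by rewrite (imaginary_scalar_solution l0 cy t0) normrM norm_cis mul1r.
Qed.

Lemma norm_toC (r : K) : `|toC r| = toC `|r|.
Proof. by rewrite normc_def /= expr0n addr0 sqrtr_sqr. Qed.

Definition functional n (v : 'rV[C]_n) (z : K -> 'cV[K]_n) (t : K) : C :=
  (v *m map_mx toC (z t)) 0 0.

Lemma functionalE n (v : 'rV[C]_n) z t :
  functional v z t = \sum_j v 0 j * toC (z t j 0).
Proof. by rewrite /functional mxE; apply: eq_bigr => j _; rewrite !mxE. Qed.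

Lemma trajectory_coord n z0 (dz z : K -> 'cV[K]_n) (j : 'I_n) :
  trajectory z0 dz z -> curve (fun t => z t j 0) (fun t => dz t j 0).
Proof.
move=> [_ cz Dz]; split.
  by move=> t; exact: (cvg_comp _ _ (cz t) (@coord_continuous _ _ _ j 0 (z t))).
move=> t t0; have [dt <-] := Dz t t0.
rewrite derive_mx // mxE; apply: derivableP.
by move/derivable_mxP: dt; exact.
Qed.

Lemma Re_sum (I : finType) (F : I -> C) : Re (\sum_i F i) = \sum_i Re (F i).
Proof. by apply: (big_morph Re ReD). Qed.

Lemma Im_sum (I : finType) (F : I -> C) : Im (\sum_i F i) = \sum_i Im (F i).
Proof. by apply: (big_morph Im ImD). Qed.

(** Testing against all complex rows gives direct access to left eigenvectors, and makes stability
    under sums and under real matrices a matter of moving the matrix onto the row. *)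
Definition weak_solution n (dz z : K -> 'cV[K]_n) : Prop :=
  forall v : 'rV[C]_n, ccurve (functional v z) (functional v dz).

Lemma trajectory_weak_solution n z0 (dz z : K -> 'cV[K]_n) :
  trajectory z0 dz z -> weak_solution dz z.
Proof.
move=> tz v; split.
  have := curve_sum (index_enum 'I_n)
    (fun j => curveZ (Re (v 0 j)) (trajectory_coord j tz)).
  apply: curve_ext => [t|t _] /=; rewrite functionalE Re_sum;
  by apply: eq_bigr => j _; rewrite ReM /= mulr0 subr0.
have := curve_sum (index_enum 'I_n)
  (fun j => curveZ (Im (v 0 j)) (trajectory_coord j tz)).
apply: curve_ext => [t|t _] /=; rewrite functionalE Im_sum;
by apply: eq_bigr => j _; rewrite ImM /= mulr0 add0r.
Qed.

Definition bounded_curve n (z : K -> 'cV[K]_n) : Prop :=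
  exists M : K, forall t, 0 <= t -> forall i, `|z t i 0| <= M.

Lemma bounded_curveP n (z : K -> 'cV[K]_n) :
  (forall v, cbounded (functional v z)) <-> bounded_curve z.
Proof.
split=> [bz|[M bz] v]; last first.
  exists (\sum_j `|v 0 j| * toC M) => t t0; rewrite functionalE.
  rewrite (le_trans (ler_norm_sum _ _ _)) // ler_sum // => j _.
  by rewrite normrM ler_wpM2l // norm_toC lecR bz.
have /choice[M bM] : forall i : 'I_n, exists M : K,
    forall t, 0 <= t -> `|z t i 0| <= M.
  move=> i; have [M bM] := bz (delta_mx 0 i); exists (Re M) => t /bM.
  by rewrite /functional -rowE !mxE norm_toC lecE => /andP[].
exists (\sum_i `|M i|) => t t0 i; rewrite (le_trans (bM i t t0)) //.
by rewrite (le_trans (ler_norm _)) // (bigD1 i) //= lerDl sumr_ge0.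
Qed.

End ComplexFunctionals.

(** * Boundedness of linear systems *)

Section LinearSystems.
Variable K : realType.
Local Notation C := K[i].
Local Notation Re := (@complex.Re K).
Local Notation toC := (real_complex K).

Lemma functionalD n (v w : 'rV[C]_n) z t :
  functional (v + w) z t = functional v z t + functional w z t.
Proof. by rewrite /functional mulmxDl mxE. Qed.

Lemma functionalZ n c (v : 'rV[C]_n) z t :
  functional (c *: v) z t = c * functional v z t.
Proof. by rewrite /functional -scalemxAl mxE. Qed.

Lemma functionalM m n (v : 'rV[C]_m) (M : 'M[K]_(m, n)) z t :
  functional v (fun t => M *m z t) t = functional (v *m map_mx toC M) z t.
Proof. by rewrite /functional map_mxM mulmxA. Qed.

Lemma functional_addr n (v : 'rV[C]_n) (z w : K -> 'cV[K]_n) t :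
  functional v (fun t => z t + w t) t = functional v z t + functional v w t.
Proof. by rewrite /functional map_mxD mulmxDr mxE. Qed.

Lemma weak_solutionM m n (M : 'M[K]_(m, n)) dz z :
  weak_solution dz z -> weak_solution (fun t => M *m dz t) (fun t => M *m z t).
Proof.
move=> sz v; apply: ccurve_ext (sz (v *m map_mx toC M)) => [t|t _];
  by rewrite functionalM.
Qed.

Lemma weak_solutionD n (dz dw z w : K -> 'cV[K]_n) :
  weak_solution dz z -> weak_solution dw w ->
  weak_solution (fun t => dz t + dw t) (fun t => z t + w t).
Proof.
move=> sz sw v; apply: ccurve_ext (ccurveD (sz v) (sw v)) => [t|t _];
  by rewrite functional_addr.
Qed.

Lemma weak_solution_ext n (dz dz' z : K -> 'cV[K]_n) : dz =1 dz' ->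
  weak_solution dz z -> weak_solution dz' z.
Proof. by move=> /funext <-. Qed.

Lemma bounded_curveD n (z w : K -> 'cV[K]_n) :
  bounded_curve z -> bounded_curve w -> bounded_curve (fun t => z t + w t).
Proof.
move=> [M bz] [N bw]; exists (M + N) => t t0 i.
by rewrite mxE (le_trans (ler_normD _ _)) // lerD ?bz ?bw.
Qed.

Lemma bounded_curveM m n (M : 'M[K]_(m, n)) (z : K -> 'cV[K]_n) :
  bounded_curve z -> bounded_curve (fun t => M *m z t).
Proof.
move=> /bounded_curveP bz; apply/bounded_curveP => v.
by apply: cbounded_ext (bz (v *m map_mx toC M)) => t _; rewrite functionalM.
Qed.

Lemma bounded_curve_ext n (z w : K -> 'cV[K]_n) : z =1 w ->
  bounded_curve z -> bounded_curve w.
Proof. by move=> /funext ->. Qed.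

(** As A may have repeated eigenvalues, its eigenvectors need not span. Instead, the linear factors
    of the characteristic polynomial are peeled off one at a time: with v' = v (A - l), the curve v
    z solves y' = l y + v' z, where the forcing v' z is bounded by induction and Re l < 0. *)
Lemma hurwitz_bounded n (A : 'M[K]_n) (z : K -> 'cV[K]_n) :
  spectrum A `<=` @open_left_half_plane K ->
  weak_solution (fun t => A *m z t) z -> bounded_curve z.
Proof.
case: n => [|n] in A z *.
  by move=> _ _; exists 0 => t _ [].
move=> Astable tz; apply/bounded_curveP => v.
have [r rE] := closed_field_poly_normal (char_poly (complexify A)).
rewrite (monicP (char_poly_monic _)) scale1r in rE.
have rA : {in r, forall l, Re l < 0}.
  move=> l lr; apply: Astable; rewrite /spectrum /= eigenvalue_root_char rE.
  by rewrite root_prod_XsubC.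
(* By Cayley-Hamilton the full product kills every row. The induction on [r] then concerns the rows
   killed by the product over the remaining roots; with no root left, the row is zero. *)
have : v *m horner_mx (complexify A) (\prod_(l <- r) ('X - l%:P)) = 0.
  by rewrite -rE Cayley_Hamilton mulmx0.
elim: r rA {rE} v => [|l r IH] rA v.
  rewrite big_nil rmorph1 mulmx1 => ->; exists 0 => t _.
  by rewrite /functional mul0mx mxE normr0.
rewrite big_cons rmorphM /= -mulmxE mulmxA rmorphB /= horner_mx_X horner_mx_C.
set v' := v *m _ => v'0.
have bv' : cbounded (functional v' z).
  by apply: IH v'0 => m mr; rewrite rA // inE mr orbT.
apply: (stable_scalar_bounded (rA l _) _ bv'); first by rewrite inE eqxx.
apply: ccurve_ext (tz v) => // t _.
rewrite functionalM -functionalZ -functionalD /v' mulmxBr mul_mx_scalar.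
by rewrite addrC subrK.
Qed.

(** The minimal polynomial divides the characteristic one, which is a product of distinct linear
    factors. The rows of P are left eigenvectors. *)
Lemma simple_diagonalization n (A : 'M[K]_n) : simple_eigenvalues A ->
  exists (P : 'M[C]_n) (D : 'rV[C]_n),
    [/\ P \in unitmx, P *m complexify A = diag_mx D *m P,
        forall i, spectrum A (D 0 i) & injective (D 0)].
Proof.
case: n => [|n] in A *.
  move=> _; exists 1%:M, 0.
  by split; [exact: unitmx1 | apply/matrixP => -[] | case | case].
move=> simA; set cA := complexify A.
have [r rE] := closed_field_poly_normal (char_poly cA).
rewrite (monicP (char_poly_monic _)) scale1r in rE.
have reig l : (l \in r) = eigenvalue cA l.
  by rewrite eigenvalue_root_char rE root_prod_XsubC.
have ur : uniq r.
  apply: count_mem_uniq => l; rewrite -mu_prod_XsubC -rE.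
  case: (boolP (l \in r)) => lr; first by rewrite simA // /spectrum /= -reig.
  by rewrite mupNroot // rE root_prod_XsubC.
have [P Pu PA] : diagonalizable cA.
  by apply/diagonalizableP; exists r => //; rewrite -rE mxminpoly_dvd_char.
have /diagonalizable_forPex[D /(simmxP Pu) PD] := PA.
have rowD i : row i P *m cA = D 0 i *: row i P.
  by rewrite -row_mul PD row_mul row_diag_mx -scalemxAl -rowE.
have Peig i : eigenvalue cA (D 0 i).
  apply/eigenvalueP; exists (row i P); first exact: rowD.
  apply/negP => /eqP Pi0; have := mulmxV Pu => /(congr1 (row i)).
  rewrite row_mul Pi0 mul0mx => /matrixP/(_ 0 i); rewrite !mxE eqxx => /eqP.
  by rewrite eq_sym oner_eq0.
exists P, D; split=> //.
(* Counting: the n distinct roots in [r] all occur among the n entries of D, so these entries are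
   distinct. *)
apply/injectiveP; rewrite /injectiveb /dinjectiveb -/(codom _).
apply: (leq_size_uniq ur) => [l|]; last first.
  have := size_char_poly cA; rewrite rE size_prod_XsubC => -[->].
  by rewrite size_codom card_ord.
rewrite reig => /eigenvalueP[v vA v0].
set w := v *m invmx P.
have vw : v = w *m P by rewrite /w mulmxKV.
have wD : w *m diag_mx D = l *: w.
  apply: (can_inj (mulmxK Pu)).
  by rewrite -mulmxA -PD mulmxA -vw vA -scalemxAl -vw.
have [j wj] : exists j, w 0 j != 0.
  apply/existsP; rewrite -negb_forall; apply: contra v0 => /forallP w0.
  suff w00 : w = 0 by rewrite vw w00 mul0mx.
  by apply/rowP => j; rewrite [RHS]mxE; exact/eqP/w0.
apply/codomP; exists j; move/rowP: wD => /(_ j).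
by rewrite mul_mx_diag [LHS]mxE [RHS]mxE mulrC => /(mulIf wj) ->.
Qed.

Lemma bounded_curve_basis n (P : 'M[C]_n) (z : K -> 'cV[K]_n) :
  P \in unitmx -> (forall i, cbounded (functional (row i P) z)) ->
  bounded_curve z.
Proof.
move=> Pu bP; apply/bounded_curveP => v.
apply: cbounded_ext (cbounded_sum (index_enum 'I_n)
  (fun i => cboundedZ ((v *m invmx P) 0 i) (bP i))) => t _.
rewrite -[in RHS](mulmxKV Pu v) /functional -(mulmxA (v *m _)) [RHS]mxE.
by apply: eq_bigr => i _; congr (_ * _); rewrite -row_mul mxE.
Qed.

Lemma functional_eigenvector n (A : 'M[K]_n) (P : 'M[C]_n) (D : 'rV[C]_n) z i :
  P *m complexify A = diag_mx D *m P ->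
  weak_solution (fun t => A *m z t) z ->
  ccurve (functional (row i P) z) (fun t => D 0 i * functional (row i P) z t).
Proof.
move=> PA tz; apply: ccurve_ext (tz _) => // t _.
by rewrite functionalM -row_mul PA row_mul row_diag_mx -scalemxAl -rowE functionalZ.
Qed.

Lemma marginally_stable_bounded n (A : 'M[K]_n) z :
  simple_eigenvalues A -> spectrum A `<=` @imaginary_axis K ->
  weak_solution (fun t => A *m z t) z -> bounded_curve z.
Proof.
move=> /simple_diagonalization[P [D [Pu PA sD _]]] imA tz.
apply: (bounded_curve_basis Pu) => i.
by apply: imaginary_scalar_bounded (functional_eigenvector i PA tz); exact/imA/sD.
Qed.

(* Non-resonance: for a left eigenvector [q] of [Q] with eigenvalue [l], the
   row [r = q G (S - l)^-1] makes [q z - r w] a solution of [u' = l u]. *)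
Lemma nonresonant_bounded m n (S : 'M[K]_m) (Q : 'M[K]_n) (G : 'M[K]_(n, m))
    (w : K -> 'cV[K]_m) (z : K -> 'cV[K]_n) :
  simple_eigenvalues Q -> spectrum Q `<=` @imaginary_axis K ->
  spectrum S `&` spectrum Q = set0 ->
  weak_solution (fun t => S *m w t) w -> bounded_curve w ->
  weak_solution (fun t => Q *m z t + G *m w t) z -> bounded_curve z.
Proof.
move=> /simple_diagonalization[P [D [Pu PQ sD _]]] imQ SQ tw /bounded_curveP bw tz.
apply: (bounded_curve_basis Pu) => i; set q := row i P; set l := D 0 i.
(* A nonzero kernel would make l a common eigenvalue of S and Q. *)
have Su : complexify S - l%:M \in unitmx.
  rewrite -row_free_unit -kermx_eq0; apply/negP => /negP Sl.
  have : (spectrum S `&` spectrum Q) l by split; [exact: Sl | exact: sD].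
  by rewrite SQ.
set r := q *m map_mx toC G *m invmx (complexify S - l%:M).
have rE : r *m complexify S = q *m map_mx toC G + l *: r.
  apply/eqP; rewrite -subr_eq -mul_mx_scalar -mulmxBr; apply/eqP.
  exact: mulmxKV.
have cu := ccurveD (tz q) (tw (- 1 *: r)).
have bu : cbounded (fun t => functional q z t + functional (- 1 *: r) w t).
  apply: (@imaginary_scalar_bounded _ l); first exact/imQ/sD.
  apply: ccurve_ext cu => // t _.
  rewrite functional_addr !functionalM -scalemxAl rE.
  have -> : q *m map_mx toC Q = l *: q.
    by rewrite /q -row_mul PQ row_mul row_diag_mx -scalemxAl -rowE.
  rewrite !functionalZ functionalD functionalZ; ring.
apply: cbounded_ext (cboundedD bu (bw r)) => t _.
by rewrite functionalZ; ring.
Qed.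

End LinearSystems.

(** * Uniform sampling *)

Section Sampling.
Variable K : realType.
Local Notation C := K[i].
Local Notation Re := (@complex.Re K).
Local Notation Im := (@complex.Im K).
Local Notation toC := (real_complex K).

Lemma cis_natmul (s : K) k : cis (k%:R * s) = cis s ^+ k.
Proof.
elim: k => [|k IH]; first by rewrite mul0r cis0.
by rewrite -natr1 mulrDl mul1r cisD IH exprSr.
Qed.

(** Since pi >= 2, the interval [-1, 1] lies in [- pi / 2, pi / 2], where the sine is injective. *)
Lemma cis_inj_small (s t : K) : `|s| <= 1 -> `|t| <= 1 -> cis s = cis t -> s = t.
Proof.
have itv (u : K) : `|u| <= 1 -> u \in `[- (pi / 2), (pi / 2)].
  have : 1 <= pi / 2 :> K by rewrite ler_pdivlMr // mul1r pi_ge2.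
  by rewrite in_itv /= -ler_norml => h1 h2; exact: le_trans h1.
by move=> /itv s1 /itv t1 [_]; exact: sin_inj.
Qed.

(** Excitation reaches every mode. If the l-th modal coordinate of w0 vanished, row l of P would
    annihilate every S^k w0, hence the invertible matrix [ctrb_mx S w0], and would be zero. *)
Lemma excitable_coord n (S : 'M[K]_n) (P : 'M[C]_n) (D : 'rV[C]_n) w0 l :
  P \in unitmx -> P *m complexify S = diag_mx D *m P -> excitable S w0 ->
  (P *m map_mx toC w0) l 0 != 0.
Proof.
move=> Pu PS exc; apply/negP => /eqP y0.
have cu : map_mx toC (ctrb_mx S w0) \in unitmx.
  by rewrite map_unitmx -row_free_unit /row_free exc.
have rPS k : row l P *m map_mx toC (S ^+ k) = D 0 l ^+ k *: row l P.
  elim: k => [|k IH]; first by rewrite !expr0 map_mx1 mulmx1 scale1r.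
  rewrite exprS -mulmxE map_mxM mulmxA -row_mul PS row_mul row_diag_mx -scalemxAl.
  by rewrite -rowE -scalemxAl IH scalerA -exprS.
have rc : row l P *m map_mx toC (ctrb_mx S w0) = 0.
  apply/rowP => k; rewrite [RHS]mxE.
  have -> : (row l P *m map_mx toC (ctrb_mx S w0)) 0 k =
      (row l P *m map_mx toC (S ^+ k *m w0)) 0 0.
    by rewrite !mxE; apply: eq_bigr => j _; rewrite !mxE.
  rewrite map_mxM mulmxA rPS -scalemxAl mxE -row_mul [X in _ * X]mxE y0.
  by rewrite mulr0.
have : row l P = 0 by rewrite -(mulmxK cu (row l P)) rc mul0mx.
move=> /(congr1 (mulmxr (invmx P))) /=; rewrite -row_mul mulmxV // mul0mx.
move=> /rowP/(_ l); rewrite !mxE eqxx => /eqP.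
by rewrite oner_eq0.
Qed.

(* In the eigenbasis, [nu] consecutive samples of [w] form a unimodular
   diagonal matrix times a fixed diagonal times a fixed Vandermonde matrix. *)
Lemma uniform_sampling_lower_bound n (S : 'M[K]_n) w0 (w : K -> 'cV[K]_n) :
  simple_eigenvalues S -> spectrum S `<=` @imaginary_axis K -> excitable S w0 ->
  trajectory w0 (fun t => S *m w t) w ->
  exists h c : K, [/\ 0 < h, 0 <= c &
    forall (a : nat) (m : nat) (X : 'M[K]_(m, n)) (b : K),
      (forall (j : 'I_n) i, `|(X *m w ((a + j)%N%:R * h)) i 0| <= b) ->
      forall i j, `|X i j| <= c * b].
Proof.
move=> /simple_diagonalization[P [D [Pu PS sD injD]]] imS exc tw.
have w0E : w 0 = w0 by have [] := tw.
pose th l := Im (D 0 l).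
have thinj : injective th.
  move=> i j ij; apply: injD; apply/eqP; rewrite eq_complex; apply/andP; split.
    by rewrite (imS _ (sD i)) (imS _ (sD j)).
  by apply/eqP.
(* N exceeds every frequency, so all angles [th l * h] lie in [-1, 1] and distinct frequencies give
   distinct points on the unit circle. *)
pose N := 1 + \sum_l `|th l|; pose h := N^-1.
have N0 : 0 < N by rewrite ltr_wpDr // sumr_ge0.
have h0 : 0 < h by rewrite invr_gt0.
have thh l : `|th l * h| <= 1.
  rewrite normrM (gtr0_norm h0) ler_pdivrMr // mul1r /N (bigD1 l) //= addrCA lerDl.
  by rewrite addr_ge0 // sumr_ge0.
pose e : 'rV[C]_n := \row_l cis (th l * h).
have einj : injective (e 0).
  move=> i j; rewrite !mxE => /(cis_inj_small (thh i) (thh j)).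
  by move=> /(mulIf (lt0r_neq0 h0)) /thinj.
pose V := (Vandermonde n e)^T.
have Vu : V \in unitmx.
  rewrite unitmx_tr unitmxE det_Vandermonde unitfE; apply/prodf_neq0 => i _.
  apply/prodf_neq0 => j ij; rewrite subr_eq0; apply/negP => /eqP /einj ji.
  by rewrite ji ltnn in ij.
pose y l := (P *m map_mx toC w0) l 0.
have y0 l : y l != 0 by exact: (excitable_coord l Pu PS exc).
have yE k : P *m map_mx toC (w (k%:R * h)) = \col_l (e 0 l ^+ k * y l).
  apply/colP => l.
  have := imaginary_scalar_solution (imS _ (sD l)) 
    (functional_eigenvector l PS (trajectory_weak_solution tw)).
  move=> /(_ (k%:R * h)); rewrite mulr_ge0 // ?ltW // => /(_ isT).
  rewrite /functional -!row_mul w0E [X in X = _ -> _]mxE => ->.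
  by rewrite [RHS]mxE [row _ _ _ _]mxE [e 0 l]mxE (mulrCA (Im _)) cis_natmul.
pose W := invmx V.
(* Entrywise bound for the inverse factorization [XE]. The start a of the window enters [g] only
   through [e 0 l ^+ a], of modulus one, so c is independent of a. *)
pose c := \sum_j \sum_l \sum_k `|W k l| * `|y l|^-1 * `|P l j|.
have c0 : 0 <= c.
  by do 3!(apply: sumr_ge0 => ? _); rewrite !mulr_ge0 ?invr_ge0.
exists h, (Re c); split=> //; first by have := c0; rewrite lecE => /andP[].
move=> a m X b Xb i j.
pose F : 'M[C]_(m, n) := \matrix_(i, j) toC ((X *m w ((a + j)%N%:R * h)) i 0).
pose g : 'rV[C]_n := \row_l (e 0 l ^+ a * y l).
have en l : `|e 0 l| = 1 by rewrite mxE norm_cis.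
have e0 l : e 0 l != 0 by rewrite -normr_eq0 en oner_eq0.
pose g' : 'rV[C]_n := \row_l (g 0 l)^-1.
have g0 l : g 0 l != 0 by rewrite mxE mulf_neq0 ?expf_neq0.
have gg : diag_mx g *m diag_mx g' = 1%:M.
  rewrite mulmx_diag; apply/matrixP => r s; rewrite [LHS]mxE [X in X *+ _]mxE.
  by rewrite [g' 0 _]mxE mulfV ?g0 // [RHS]mxE.
(* Mode l at sample a + s is e_l^(a + s) y_l, that is, g_l times the Vandermonde entry e_l^s. *)
have FE : F = map_mx toC X *m invmx P *m diag_mx g *m V.
  apply/matrixP => r s; rewrite mxE.
  have -> : toC ((X *m w ((a + s)%N%:R * h)) r 0) =
     (map_mx toC X *m invmx P *m (P *m map_mx toC (w ((a + s)%N%:R * h)))) r 0.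
    by rewrite mulmxA mulmxKV // -map_mxM [RHS]mxE.
  rewrite yE -(mulmxA _ (diag_mx g)) [LHS]mxE [RHS]mxE.
  apply: eq_bigr => l _; congr (_ * _).
  by rewrite mul_diag_mx !mxE exprD mulrAC.
have XE : map_mx toC X = F *m W *m diag_mx g' *m P.
  by rewrite FE /W mulmxK // -(mulmxA _ (diag_mx g)) gg mulmx1 mulmxKV.
have b0 : 0 <= b by apply: le_trans (Xb j i).
have -> : Re c * b = Re (c * toC b) by rewrite ReM /= mulr0 subr0.
suff : toC `|X i j| <= c * toC b by rewrite lecE => /andP[].
rewrite -norm_toC.
have -> : toC (X i j) = map_mx toC X i j by rewrite mxE.
pose cj := \sum_l \sum_k `|W k l| * `|y l|^-1 * `|P l j|.
have cjc : cj <= c.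
  rewrite [leRHS](bigD1 j) //= lerDl.
  by do 3!(apply: sumr_ge0 => ? _); rewrite !mulr_ge0 ?invr_ge0.
apply: (@le_trans _ _ (cj * toC b)); last by rewrite ler_wpM2r ?ler0c.
rewrite XE mxE (le_trans (ler_norm_sum _ _ _)) // mulr_suml ler_sum // => l _.
rewrite mul_mx_diag [X in `|X * _|]mxE [(F *m W) _ _]mxE [g' 0 _]mxE !mulr_suml.
rewrite (le_trans (ler_norm_sum _ _ _)) // ler_sum // => k _.
rewrite !normrM normfV [g 0 l]mxE normrM normrX en expr1n mul1r.
rewrite [leRHS]mulrC !mulrA !ler_wpM2r ?invr_ge0 //.
by rewrite mxE norm_toC lecR.
Qed.

End Sampling.

(** * Least squares *)

Section LeastSquares.
Variable K : realType.

Lemma stack_mx_mul p m n q (F : 'I_p -> 'M[K]_(m, n)) (M : 'M[K]_(n, q)) :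
  stack_mx F *m M = stack_mx (fun j => F j *m M).
Proof.
apply/matrixP => i j; rewrite [LHS]mxE [RHS]mxE mxE.
by apply: eq_bigr => l _; rewrite mxE.
Qed.

(** Blockwise, this is the Kronecker identity [tens_tr_vec]. It turns the regression on vec X into
    samples of X w, to which the sampling bound applies. *)
Lemma O_mx_vec nu p (w : K -> 'cV[K]_nu) t k (X : 'M[K]_nu) :
  O_mx p w t k *m vec X = stack_mx (fun j : 'I_p => X *m w (window t k j)).
Proof.
rewrite /O_mx stack_mx_mul; congr stack_mx; apply/funext => j.
exact: tens_tr_vec.
Qed.

Lemma stack_mxE p m n (F : 'I_p -> 'M[K]_(m, n)) j a b :
  stack_mx F (mxtens_index (j, a)) b = F j a b.
Proof. by rewrite mxE mxtens_indexK. Qed.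

Lemma limn_esup_le (u : nat -> \bar K) (l : \bar K) :
  (forall n, (u n <= l)%E) -> (limn_esup u <= l)%E.
Proof.
move=> ul; rewrite limn_esup_lim; apply: lime_le; first exact: is_cvg_esups.
by apply: nearW => m; apply: ge_ereal_sup => _ [n /= mn] <-.
Qed.

Lemma mx_norm_le m n (M : 'M[K]_(m, n)) (b : K) :
  0 <= b -> (forall i j, `|M i j| <= b) -> `|M| <= b.
Proof.
move=> b0 Mb; rewrite [leLHS]/Num.Def.normr /= mx_normrE.
by apply: bigmax_le => // -[i j] _; exact: Mb.
Qed.

(* By the normal equations, [r = O u] satisfies [r . r = r . b]. *)
Lemma least_squares_bound m k (O : 'M[K]_(m, k)) (y : 'cV[K]_m) (b : K) :
  O^T *m O \in unitmx -> (forall i, `|y i 0| <= b) ->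
  forall i, `|(O *m (invmx (O^T *m O) *m O^T *m y)) i 0| <= m.+1%:R * b.
Proof.
move=> Ou yb i; set u := invmx _ *m _ *m _; set r := O *m u.
have Nor : O^T *m r = O^T *m y.
  by rewrite /r mulmxA /u -(mulmxA _ O^T y) mulKVmx.
have rr : \sum_j r j 0 * r j 0 = \sum_j r j 0 * y j 0.
  have : r^T *m r = r^T *m y by rewrite {1 3}/r trmx_mul -!mulmxA Nor.
  by move=> /matrixP/(_ 0 0); rewrite !mxE; under eq_bigr do rewrite mxE;
     under [RHS]eq_bigr do rewrite mxE.
(* Expanding |r - y|^2 >= 0 with r . r = r . y gives |r|^2 <= |y|^2: a projection does not increase
   the norm. *)
have ry : \sum_j r j 0 ^+ 2 <= \sum_j y j 0 ^+ 2.
  have : 0 <= \sum_j (r j 0 - y j 0) ^+ 2 by apply: sumr_ge0 => j _; exact: sqr_ge0.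
  have -> : \sum_j (r j 0 - y j 0) ^+ 2 = \sum_j y j 0 ^+ 2 - \sum_j r j 0 ^+ 2 +
     (2 * (\sum_j r j 0 * r j 0 - \sum_j r j 0 * y j 0)).
    rewrite -!sumrB mulr_sumr -big_split; apply: eq_bigr => j _ /=; ring.
  by rewrite rr subrr mulr0 addr0 subr_ge0.
have b0 : 0 <= b by apply: le_trans (yb i).
(* |y|^2 is at most m b^2, and m <= (m + 1)^2 again avoids a square root. *)
have ri : r i 0 ^+ 2 <= (m.+1%:R * b) ^+ 2.
  have le1 : r i 0 ^+ 2 <= \sum_j r j 0 ^+ 2.
    by rewrite [leRHS](bigD1 i) //= lerDl sumr_ge0 // => j _; exact: sqr_ge0.
  rewrite (le_trans le1) // (le_trans ry) // exprMn.
  have : \sum_(j < m) y j 0 ^+ 2 <= \sum_(j < m) b ^+ 2.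
    by apply: ler_sum => j _; rewrite -real_normK ?num_real // ler_pXn2r ?nnegrE.
  move=> /le_trans; apply; rewrite sumr_const card_ord -[leLHS]mulr_natl.
  rewrite ler_wpM2r ?sqr_ge0 // -natrX ler_nat.
  by rewrite (leq_trans (leqnSn m)) // -[leqLHS]mul1n leq_mul2r.
by rewrite -(@ler_pXn2r _ 2) ?nnegrE ?mulr_ge0 // real_normK // num_real.
Qed.

(** If O^T O v = 0 then |O v|^2 = 0, and a vanishing sum of real squares forces O v = 0. *)
Lemma gram_unitmx m k (O : 'M[K]_(m, k)) :
  (forall u : 'cV_k, O *m u = 0 -> u = 0) -> O^T *m O \in unitmx.
Proof.
move=> Oinj; rewrite -row_free_unit -kermx_eq0.
apply/eqP/row_matrixP => i; rewrite row0; apply/trmx_inj; rewrite trmx0.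
set v := row i _; apply: Oinj.
have vO : v *m (O^T *m O) = 0 by rewrite /v -row_mul mulmx_ker row0.
set r := O *m v^T.
have : r^T *m r = 0.
  by rewrite /r trmx_mul trmxK -mulmxA (mulmxA O^T) mulmxA vO mul0mx.
move=> /matrixP/(_ 0 0); rewrite [LHS]mxE [RHS]mxE => /eqP.
rewrite psumr_eq0 => [/allP r0|j _]; last by rewrite mxE -expr2 sqr_ge0.
apply/colP => j; rewrite [RHS]mxE; have := r0 j (mem_index_enum j).
by rewrite mxE -expr2 sqrf_eq0 => /eqP.
Qed.

End LeastSquares.

(** * Error bound for the moment estimate along uniform samples *)

Theorem theorem6 (K : realType) (n nu : nat)
  (A : 'M[K]_n) (B : 'cV[K]_n) (C : 'rV[K]_n)
  (S Q : 'M[K]_nu) (L : 'rV[K]_nu) (R : 'cV[K]_nu)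
  (Pi : 'M[K]_(n, nu)) (Upsilon : 'M[K]_(nu, n))
  (omega0 : 'cV[K]_nu) (omega : K -> 'cV[K]_nu) (x : K -> 'cV[K]_n)
  (varpi d : K -> 'cV[K]_nu)
  (tau : K) (varpi_imp : K -> 'cV[K]_nu) (UB : 'cV[K]_nu)
  (dhat : K -> 'cV[K]_nu) (p : nat)
  (AB_controllable : controllable A B)
  (AC_observable : observable A C)
  (Pi_sylvester : A *m Pi + B *m L = Pi *m S)
  (Upsilon_sylvester : Q *m Upsilon = Upsilon *m A + R *m C)
  (omega_sol : trajectory omega0 (fun t => S *m omega t) omega)
  (x_sol : trajectory 0 (fun t => A *m x t + B *m L *m omega t) x)
  (varpi_sol : trajectory 0 (fun t => Q *m varpi t + R *m C *m x t) varpi)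
  (d_def : forall t, 0 <= t -> d t = varpi t + Upsilon *m x t)
  (SL_observable : observable S L)
  (QR_controllable : controllable Q R)
  (A_stable : spectrum A `<=` @open_left_half_plane K)
  (S_simple : simple_eigenvalues S)
  (S_imaginary : spectrum S `<=` @imaginary_axis K)
  (S_omega0_excitable : excitable S omega0)
  (Q_simple : simple_eigenvalues Q)
  (Q_imaginary : spectrum Q `<=` @imaginary_axis K)
  (SA_disjoint : spectrum S `&` spectrum A = set0)
  (QA_disjoint : spectrum Q `&` spectrum A = set0)
  (SQ_disjoint : spectrum S `&` spectrum Q = set0)
  (tau_gt0 : 0 < tau)
  (varpi_imp_sol : trajectory 0
     (fun t => Q *m varpi_imp t + R *m C *m impulse_state A B t) varpi_imp)
  (UB_def : UB = expmx (- tau *: Q) *m varpi_imp tau)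
  (dhat_sol : trajectory 0 (fun t => Q *m dhat t + UB *m L *m omega t) dhat)
  (nu_le_p : (nu <= p)%N) :
  exists t : nat -> K,
    [/\ forall k, 0 <= t k,
        t @ \oo --> +oo,
        forall k, (p <= k.+1)%N ->
          (O_mx p omega t k)^T *m O_mx p omega t k \in unitmx &
        exists gamma : K, 0 < gamma /\
          (limn_esup (fun k : nat =>
             `|moment_estimate p omega dhat varpi t k - Upsilon *m Pi|%:E)
           <= gamma%:E)%E].
Proof.
have w_sol := trajectory_weak_solution omega_sol.
have b_omega := marginally_stable_bounded S_simple S_imaginary w_sol.
have b_x : bounded_curve x.
  have sz := weak_solutionD (trajectory_weak_solution x_sol)
    (weak_solutionM (- Pi) w_sol).
  (* By the Sylvester equation for Pi, x - Pi omega solves z' = A z. *)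
  have bz : bounded_curve (fun t => x t + - Pi *m omega t).
    apply: hurwitz_bounded A_stable (weak_solution_ext _ sz) => t.
    rewrite mulmxDr !mulNmx mulmxN !mulmxA -Pi_sylvester.
    by rewrite mulmxDl opprD addrA addrAC addrK addrC.
  apply: bounded_curve_ext (bounded_curveD bz (bounded_curveM Pi b_omega)) => t.
  by rewrite mulNmx subrK.
(* By the Sylvester equation for Upsilon, the terms in x combine into Q Upsilon x, leaving y' = Q y
   + Upsilon B L omega. *)
have b_y : bounded_curve (fun t => varpi t + Upsilon *m x t).
  have sy := weak_solutionD (trajectory_weak_solution varpi_sol)
    (weak_solutionM Upsilon (trajectory_weak_solution x_sol)).
  apply: (nonresonant_bounded (G := Upsilon *m B *m L) Q_simple Q_imaginary
    SQ_disjoint w_sol b_omega).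
  apply: weak_solution_ext sy => t.
  rewrite !mulmxDr !mulmxA Upsilon_sylvester mulmxDl addrA; congr (_ + _).
  by rewrite -!addrA; congr (_ + _); exact: addrC.
have b_dhat := nonresonant_bounded Q_simple Q_imaginary SQ_disjoint w_sol b_omega
  (trajectory_weak_solution dhat_sol).
(* The residual is dhat - (varpi + Upsilon x) + Upsilon x - Upsilon Pi omega, a sum of bounded
   curves. *)
have [M bM] : bounded_curve
    (fun t => dhat t - varpi t - Upsilon *m Pi *m omega t).
  have := bounded_curveD (bounded_curveD b_dhat (bounded_curveM (- 1%:M) b_y))
    (bounded_curveD (bounded_curveM Upsilon b_x)
      (bounded_curveM (- (Upsilon *m Pi)) b_omega)).
  apply: bounded_curve_ext => t.
  by rewrite mulNmx mul1mx mulNmx opprD !addrA addrNK.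
have [h [c [h0 c0 lower]]] :=
  uniform_sampling_lower_bound S_simple S_imaginary S_omega0_excitable omega_sol.
pose t k : K := k%:R * h.
(* The first nu of the p blocks suffice. For k + 1 < p the truncated subtraction makes the window
   start at index 0, so the bound holds for every k. *)
have lowerO k (X : 'M[K]_nu) b :
    (forall i, `|(O_mx p omega t k *m vec X) i 0| <= b) ->
    forall i j, `|X i j| <= c * b.
  move=> Ob; apply: (lower (k.+1 - p)%N) => j i.
  have := Ob (mxtens_index (widen_ord nu_le_p j, i)).
  by rewrite O_mx_vec stack_mxE.
(* [lowerO] with b = 0 says that O_k is injective. *)
have gram k : (O_mx p omega t k)^T *m O_mx p omega t k \in unitmx.
  apply: gram_unitmx => u Ou.
  rewrite -[u]unvecK in Ou *.
  suff -> : unvec u = 0 by rewrite /vec trmx0 linear0 trmx0.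
  apply/matrixP => i j; rewrite [RHS]mxE; apply/eqP; rewrite -normr_le0.
  by rewrite -(mulr0 c); apply: (lowerO k) => l; rewrite Ou mxE normr0.
have t0 k : 0 <= t k by rewrite mulr_ge0 // ltW.
exists t; split => //.
  apply/cvgryPge => r; move/cvgryPge: (@cvgr_idn K) => /(_ (r / h)).
  by apply: filterS => k; rewrite ler_pdivrMr.
(* The factor c comes from inverting the samples, p nu + 1 from least squares, and M bounds the
   residual; the added 1 makes gamma strictly positive. *)
exists (c * ((p * nu).+1%:R * `|M|) + 1); split.
  by rewrite ltr_wpDl // !mulr_ge0.
apply: limn_esup_le => k; rewrite lee_fin.
set b := c * _; have b0 : 0 <= b by rewrite !mulr_ge0.
apply: (@le_trans _ _ b); last by rewrite lerDl.
apply: mx_norm_le => //; apply: (lowerO k) => i.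
set O := O_mx p omega t k.
(* The blocks of [y] are the sampled residuals. As the pseudo-inverse of O is a left inverse,
   applying it to [y] gives the estimation error. *)
pose y := P_mx p dhat varpi t k - O *m vec (Upsilon *m Pi).
have -> : vec (moment_estimate p omega dhat varpi t k - Upsilon *m Pi) =
    invmx (O^T *m O) *m O^T *m y.
  rewrite /y mulmxBr -/O -(mulmxA _ O^T (O *m _)) (mulmxA O^T) mulKmx; last exact: gram.
  by rewrite /vec !linearB /= -/(vec _) unvecK.
apply: least_squares_bound; first exact: gram.
move=> {}i; have : `|y i 0| <= M.
  rewrite /y O_mx_vec /P_mx -(mxtens_unindexK i).
  case: (mxtens_unindex i) => j l; rewrite mxE [X in _ + X]mxE !stack_mxE.
  by have := bM _ (t0 (k.+1 - p + j)%N) l; rewrite [X in `|X| <= _]mxE [X in _ + X]mxE.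
by move=> /le_trans; apply; exact: ler_norm.
Qed.
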